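(* Let $\mathbb{F}_q$ be the finite field with $q$ elements (of any characteristic), and let $(V,Q,U)$ be a non-degenerate virtual quadratic space over $\mathbb{F}_q$. (1) If $\dim U=2k$ with $k\ge 1$ and $Q|_U$ is of type $\varepsilon\in\{+1,-1\}$, then $$|\mathrm{Iso}(V,U)|=2q^{k^2-k}(q^{k}-\varepsilon)\prod_{i=1}^{k-1}(q^{2i}-1).$$ (2) If $\dim U=2k+1$ with $k\ge 0$, then $$|\mathrm{Iso}(V,U)|=2q^{k^2}\prod_{i=1}^{k}(q^{2i}-1).$$
   Context: All vector spaces are finite-dimensional. For a quadratic form $Q$ on a vector space $V$, the associated bilinear form is $B(x,y)=Q(x+y)-Q(x)-Q(y)$, and $\perp$ refers to $B$. $Q$ is non-degenerate if $B$ is non-degenerate. The radical of a quadratic form $Q$ is $\mathrm{Rad}\,Q=\{v : Q(v+u)=Q(u)\text{ for all }u\}$. A virtual quadratic space is a triple $(V,Q,U)$ (also written $(V,U)$), where $Q$ is a non-degenerate quadratic form on the vector space $V$ and $U$ is a subspace of $V$; its dimension is $\dim U$. It is non-degenerate if $\mathrm{Rad}(Q|_U)=\{0\}$. $\mathrm{Iso}(V,U)$ is the group of linear isometries of $(V,Q)$ (linear maps $\varphi\colon V\to V$ with $Q(\varphi(v))=Q(v)$ for all $v$) that fix $U^\perp\subseteq V$ pointwise. Types: a quadratic form of dimension $2k$ with trivial radical over $\mathbb{F}_q$ is of type $+$ ($\varepsilon=+1$) if it is isomorphic to $\sum_{i=1}^{k}x_{2i-1}x_{2i}$. It is of type $-$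 ($\varepsilon=-1$) if it is isomorphic to $\sum_{i=1}^{k-1}x_{2i-1}x_{2i}+x_{2k-1}^2-\mathbf{e}\,x_{2k}^2$ when $q$ is odd, where $\mathbf{e}\in\mathbb{F}_q$ is a fixed non-square, respectively to $\sum_{i=1}^{k-1}x_{2i-1}x_{2i}+x_{2k-1}^2+x_{2k-1}x_{2k}+\mathbf{e}\,x_{2k}^2$ when $q$ is even, where $\mathbf{e}\in\mathbb{F}_q$ is a fixed element such that $x^2+x+\mathbf{e}$ has no root in $\mathbb{F}_q$. *)

(* Defs.v *)
From HB Require Import structures.
From mathcomp Require Import all_boot all_order all_algebra finfield.
Set Implicit Arguments.
Unset Strict Implicit.
Unset Printing Implicit Defensive.
Import GRing.Theory.
Local Open Scope ring_scope.

Section QuadraticForms.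

Variables (F : fieldType) (V : vectType F).

Record quadform := QuadForm {
  qform :> V -> F;
  qformZ : forall a v, qform (a *: v) = a ^+ 2 * qform v;
  qform_bilinear : bilinear_for *%R *%R
    (fun x y => qform (x + y) - qform x - qform y)
}.

Variable Q : quadform.

Definition polar (x y : V) : F := Q (x + y) - Q x - Q y.

Fact polar_is_bilinear : bilinear_for *%R *%R polar.
Proof. exact: qform_bilinear. Qed.

(* idfun \; *%R is the scaling law that {symmetric V} expects. *)
HB.instance Definition _ :=
  bilinear_isBilinear.Build F V V F *%R (idfun \; *%R)
    polar polar_is_bilinear.

Fact polar_is_symmetric x y :
  polar x y = (-1) ^+ false * idfun (polar y x).
Proof. by rewrite expr0 mul1r /= /polar (addrC x y) addrAC. Qed.

(* With this instance, nondegenerate (polar Q) and orthov (polar Q) U are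
   non-degeneracy and the orthogonal complement with respect to B. *)
HB.instance Definition _ :=
  isHermitianSesquilinear.Build F V false idfun polar polar_is_symmetric.

(* In characteristic 2 this radical may be strictly smaller than the radical
   of the polar form. *)
Definition qrad (v : V) : Prop := forall u, Q (v + u) = Q u.

Definition trivial_qrad : Prop := forall v, qrad v -> v = 0.

End QuadraticForms.

Section Restriction.

Variables (F : fieldType) (V : vectType F) (Q : quadform V) (U : {vspace V}).

Definition qres_fun (u : subvs_of U) : F := Q (vsval u).

Fact qres_funZ a u : qres_fun (a *: u) = a ^+ 2 * qres_fun u.
Proof. by rewrite /qres_fun linearZ qformZ. Qed.

Fact qres_fun_bilinear : bilinear_for *%R *%R
  (fun x y => qres_fun (x + y) - qres_fun x - qres_fun y).
Proof.
have [Bl Br] := qform_bilinear Q.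
rewrite /qres_fun; split=> [y|x] a u v /=.
  exact: Bl (vsval y) a (vsval u) (vsval v).
exact: Br (vsval x) a (vsval u) (vsval v).
Qed.

Definition qres : quadform (subvs_of U) :=
  QuadForm qres_funZ qres_fun_bilinear.

End Restriction.

Definition qisometric (F : fieldType) (V W : vectType F)
    (P : V -> F) (R : W -> F) : Prop :=
  exists f : {linear V -> W}, bijective f /\ forall v, R (f v) = P v.

Section FiniteFields.

Variable F : finFieldType.

(* The coordinates (x_1, ..., x_2k) are arranged in a k x 2 matrix whose i-th
   row (counting from 1) is (x_(2i-1), x_(2i)). *)
Definition plus_form (k : nat) (x : 'M[F]_(k, 2)) : F :=
  \sum_i x i 0 * x i 1.

Definition minus_parameter (e : F) : Prop :=
  if odd #|F| then forall x : F, x ^+ 2 != e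
  else forall x : F, x ^+ 2 + x + e != 0.

Definition minus_plane (e a b : F) : F :=
  if odd #|F| then a ^+ 2 - e * b ^+ 2
  else a ^+ 2 + a * b + e * b ^+ 2.

(* The form has dimension 2(k+1). *)
Definition minus_form (k : nat) (e : F) (x : 'M[F]_(k.+1, 2)) : F :=
  \sum_(i | i != ord_max) x i 0 * x i 1 +
  minus_plane e (x ord_max 0) (x ord_max 1).

(* The minus type does not depend on which admissible e is fixed, hence the
   existential quantifier. *)
Definition has_type (V : vectType F) (Q : quadform V) (eps : int) : Prop :=
  trivial_qrad Q /\
  ((eps = 1 /\ exists k, qisometric Q (@plus_form k)) \/
   (eps = -1 /\ exists k e,
      minus_parameter e /\ qisometric Q (@minus_form k e))).

(* finvect_type is the library's alias that makes 'End(V) a finite type. Such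
   an f is automatically bijective when polar Q is non-degenerate. *)
Definition Iso (V : vectType F) (Q : quadform V) (U : {vspace V}) :
    {set finvect_type 'End(V)} :=
  [set f : finvect_type 'End(V) |
    [forall v : finvect_type V, Q ((f : 'End(V)) v) == Q v] &&
    (orthov (polar Q) U <= fixedSpace (f : 'End(V)))%VS].

End FiniteFields.

(* Main.v *)
Require Import Defs.
From HB Require Import structures.
From mathcomp Require Import all_boot all_order all_algebra finfield.
From mathcomp Require Import ring zify.
Set Implicit Arguments.
Unset Strict Implicit.
Unset Printing Implicit Defensive.
Import GRing.Theory.
Local Open Scope ring_scope.

(* The stabiliser of u in Iso(V,U) is Iso(V, U :&: u^perp), so orbit counting
   gives |Iso(V,U)| = |orbit of u| * |Iso(V, U :&: u^perp)|.  If U contains a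
   nonzero singular vector, two such steps along a hyperbolic pair (u, v) lead to
   the non-degenerate space W = U :&: u^perp :&: v^perp of dimension dim U - 2:
   with N the number of singular vectors, 0 included,
     |Iso(V,U)| = (N(U) - 1) q^(dim W) |Iso(V,W)|,
     N(U) = q N(W) + (q - 1) q^(dim W).
   Reflections and Eichler transformations along vectors of U give the required
   transitivity.  In even dimension the type enters only through N(U).  The
   recursion ends at dim U = 0, at dim U = 1, where the only isometries are the
   identity and a reflection, and at anisotropic planes. *)

(** * Polar form and orthogonal complements *)

Section PolarForm.

Variables (F : fieldType) (V : vectType F) (Q : quadform V).
Local Notation B := (polar Q).
Implicit Types (u v w x y : V) (a : F) (U W : {vspace V}).

Lemma qformD u v : Q (u + v) = Q u + Q v + B u v.
Proof. by rewrite /polar; ring. Qed.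

Lemma polarC u v : B u v = B v u.
Proof. by rewrite /polar [u + v]addrC; ring. Qed.

Lemma polarDl u v w : B (u + v) w = B u w + B v w.
Proof. by have := (polar_is_bilinear Q).1 w 1 u v; rewrite /= scale1r mul1r. Qed.

Lemma polar0l v : B 0 v = 0.
Proof. by have := polarDl 0 0 v; rewrite addr0 => /eqP; rewrite addrC -subr_eq subrr => /eqP. Qed.

Lemma polarZl a u w : B (a *: u) w = a * B u w.
Proof.
by have := (polar_is_bilinear Q).1 w a u 0; rewrite /= addr0 -/(polar Q 0 w) polar0l addr0.
Qed.

Lemma polarDr u v w : B w (u + v) = B w u + B w v.
Proof. by rewrite polarC polarDl !(polarC w). Qed.

Lemma polarZr a u w : B w (a *: u) = a * B w u.
Proof. by rewrite polarC polarZl (polarC w). Qed.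

Lemma polar0r v : B v 0 = 0.
Proof. by rewrite polarC polar0l. Qed.

Lemma polarNl u w : B (- u) w = - B u w.
Proof. by rewrite -scaleN1r polarZl mulN1r. Qed.

Lemma polarNr u w : B w (- u) = - B w u.
Proof. by rewrite polarC polarNl polarC. Qed.

Definition polarE := (polarDl, polarDr, polarNl, polarNr, polarZl, polarZr).

Lemma qformN v : Q (- v) = Q v.
Proof. by rewrite -scaleN1r qformZ; ring. Qed.

Lemma qform0 : Q 0 = 0.
Proof. by rewrite -(scale0r 0) qformZ; ring. Qed.

Lemma polarxx v : B v v = 2 * Q v.
Proof. by rewrite /polar -mulr2n -scaler_nat qformZ; ring. Qed.

Definition qformE := (qformD, qformN, qformZ, polarE, polarxx).


Lemma orthov_polarP U v : reflect {in U, forall w, B v w = 0} (v \in orthov B U).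
Proof. exact: mem_orthovP. Qed.

Lemma orthov_polarPn U v :
  reflect (exists2 w, w \in U & B v w != 0) (v \notin orthov B U).
Proof. exact: mem_orthovPn. Qed.

Lemma mem_orthov1_polar u v : (u \in orthov B <[v]>) = (B u v == 0).
Proof. exact: mem_orthov1. Qed.

Lemma orthov_addv U W : orthov B (U + W)%VS = (orthov B U :&: orthov B W)%VS.
Proof.
by apply/vspaceP => x; rewrite memv_cap !(mem_orthov_sym B _ x) subv_add.
Qed.

(** Each vector of a basis of [U] lowers the dimension of the complement by at most one. *)
Lemma leq_dim_orthov U : (\dim {:V} <= \dim (orthov B U) + \dim U)%N.
Proof.
have [s <- ->] : exists2 s, <<s>>%VS = U & \dim U = size s.
  by exists (vbasis U); rewrite ?size_tuple // (span_basis (vbasisP U)).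
elim: s => [|x s IH] /=; first by rewrite span_nil orthov0 addn0.
rewrite span_cons orthov_addv capvC addnS.
have := leq_dim_orthov1 B x (orthov B <<s>>); lia.
Qed.

Hypothesis nondegB : nondegenerate B.

Lemma nondegP v : (forall w, B v w = 0) -> v = 0.
Proof.
move=> Bv0; apply/eqP; rewrite -memv0 -(eqP nondegB).
by apply/orthov_polarP => w _; apply: Bv0.
Qed.

(* U^perp and (U^C)^perp meet in the radical of V, which is 0, and each has at
   least the expected dimension. *)
Lemma dim_orthov U : (\dim (orthov B U) + \dim U)%N = \dim {:V}.
Proof.
apply/eqP; rewrite eqn_leq leq_dim_orthov andbT.
have dimC : \dim {:V} = (\dim U + \dim U^C)%N.
  by rewrite -(addv_complf U) dimv_disjoint_sum // capv_compl.
have cap0 : (orthov B U :&: orthov B U^C)%VS = 0%VS.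
  by rewrite -orthov_addv addv_complf; apply/eqP.
have := dimvS (subvf (orthov B U + orthov B U^C)%VS).
rewrite dimv_disjoint_sum //; have := leq_dim_orthov U^C%VS; lia.
Qed.

Lemma orthovK U : orthov B (orthov B U) = U.
Proof.
apply/eqP; rewrite eq_sym eqEdim orthov_sym subvv /=.
by rewrite -(leq_add2r (\dim (orthov B U))) dim_orthov addnC dim_orthov.
Qed.

Lemma orthov_cap U W : orthov B (U :&: W)%VS = (orthov B U + orthov B W)%VS.
Proof. by rewrite -[RHS]orthovK orthov_addv !orthovK. Qed.

End PolarForm.

(** * The group [Iso]: orbit counting, reflections and Eichler transformations *)

Section Isometries.

Variables (F : finFieldType) (V : vectType F) (Q : quadform V).
Local Notation B := (polar Q).
Implicit Types (u v w x y : V) (a : F) (U W : {vspace V}) (f g : 'End(V)).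

Hypothesis nondegB : nondegenerate B.

Lemma IsoP U f :
  reflect ((forall v, Q (f v) = Q v) /\ {in orthov B U, forall w, f w = w})
          (f \in Iso Q U).
Proof.
rewrite (@in_set (finvect_type 'End(V))); apply: (iffP andP) => -[Qf fU]; split.
- by move=> v; apply/eqP; apply: (forallP Qf v).
- by move=> w /(subvP fU)/fixedSpaceP.
- by apply/forallP => v; apply/eqP.
- by apply/subvP => w /fU fw; apply/fixedSpaceP.
Qed.

Lemma iso_polar U f u v : f \in Iso Q U -> B (f u) (f v) = B u v.
Proof. by case/IsoP => Qf _; rewrite /polar -linearD !Qf. Qed.

Lemma iso_lker0 U f : f \in Iso Q U -> lker f == 0%VS.
Proof.
move=> fI; apply/eqP/vspaceP => v; rewrite memv_ker memv0.
apply/eqP/eqP => [fv0|->]; last by rewrite linear0.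
apply: (nondegP nondegB) => w.
by rewrite -(iso_polar _ _ fI) fv0 polar0l.
Qed.

Lemma iso_comp U f g : f \in Iso Q U -> g \in Iso Q U -> (f \o g)%VF \in Iso Q U.
Proof.
case/IsoP => Qf fU /IsoP[Qg gU]; apply/IsoP; split=> [v|w wU].
  by rewrite lfunE /= Qf Qg.
by rewrite lfunE /= gU ?fU.
Qed.

Lemma iso_inv U f : f \in Iso Q U -> (f^-1)%VF \in Iso Q U.
Proof.
move=> fI; have fK := lker0_lfunVK (iso_lker0 fI); have fK' := lker0_lfunK (iso_lker0 fI).
case/IsoP: fI => Qf fU; apply/IsoP; split=> [v|w wU]; first by rewrite -Qf fK.
by rewrite -{1}(fU w wU) fK'.
Qed.

(** [U] is the complement of [orthov B U], which [f] fixes pointwise, and [f] preserves [B]. *)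
Lemma iso_stable U f u : f \in Iso Q U -> u \in U -> f u \in U.
Proof.
move=> fI uU; rewrite -(orthovK nondegB U); apply/orthov_polarP => w wU.
have [_ fU] := IsoP _ _ fI; rewrite -(fU w wU) (iso_polar _ _ fI) polarC.
by move/orthov_polarP: wU; apply.
Qed.

(** By duality the complement of [U :&: orthov B <[u]>] is [orthov B U + <[u]>], so fixing it
    pointwise means fixing both [orthov B U] and [u]. *)
Lemma iso_stab U u f :
  (f \in Iso Q (U :&: orthov B <[u]>)) = (f \in Iso Q U) && (f u == u).
Proof.
apply/IsoP/andP => [[Qf fU]|[/IsoP[Qf fU] /eqP fu]].
  have fix_in w : w \in (orthov B U + <[u]>)%VS -> f w = w.
    by rewrite -{1}(orthovK nondegB <[u]>) -orthov_cap //; apply: fU.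
  split; last by apply/eqP/fix_in/(subvP (addvSr _ _))/memv_line.
  by apply/IsoP; split=> // w wU; apply/fix_in/(subvP (addvSl _ _)).
split=> // w; rewrite orthov_cap // (orthovK nondegB) => /memv_addP[x xU [y /vlineP[a ->] ->]].
by rewrite linearD linearZ /= fu fU.
Qed.

(** Orbit-stabiliser: the hypotheses make [S] the orbit of [u]. The isometries sending [u] to a
    given [u'] form a left coset of the stabiliser, which [iso_stab] identifies. *)
Lemma card_iso_orbit U u (S : {set finvect_type V}) :
    {in Iso Q U, forall f : 'End(V), (f u : finvect_type V) \in S} ->
    {in S, forall u', exists2 f : 'End(V), f \in Iso Q U & f u = u'} ->
  #|Iso Q U| = (#|S| * #|Iso Q (U :&: orthov B <[u]>)|)%N.
Proof.
move=> inS onS.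
pose ev (f : finvect_type 'End(V)) : finvect_type V := (f : 'End(V)) u.
rewrite -sum1_card (partition_big ev (mem S)) //=.
rewrite -sum_nat_const; apply: eq_bigr => u' /onS[g gI gu].
have gK := lker0_lfunVK (iso_lker0 gI); have gK' := lker0_lfunK (iso_lker0 gI).
pose h (f : finvect_type 'End(V)) : finvect_type 'End(V) := ((g : 'End(V)) \o f)%VF.
have h_inj : injective h.
  move=> f1 f2 /lfunP eqh; apply/lfunP => v.
  by have := eqh v; rewrite !lfunE /= => /(can_inj gK').
rewrite sum1_card -[RHS](card_imset _ h_inj); apply: eq_card => f.
rewrite unfold_in; apply/andP/imsetP => [[fI /eqP fu]|[f0 f0I ->]].
  exists ((g^-1 \o (f : 'End(V)))%VF); last first.
    by apply/lfunP => v; rewrite !lfunE /= lfunE /= gK.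
  by rewrite iso_stab iso_comp ?iso_inv //= lfunE /= -/(ev f) fu -gu gK' eqxx.
have /andP[f0U /eqP f0u] : _ && _ := etrans (esym (iso_stab U u f0)) f0I.
split; first exact: iso_comp.
by rewrite /ev /h comp_lfunE f0u gu.
Qed.

(** Reflections and Eichler transformations are both the identity plus a combination of such
    rank-one maps. *)
Definition rank1_fun u x v := B v u *: x.

Fact rank1_fun_is_linear u x : linear (rank1_fun u x).
Proof. by move=> a v w; rewrite /rank1_fun !polarE scalerDl scalerA. Qed.

HB.instance Definition _ u x :=
  GRing.isLinear.Build F V V *:%R (rank1_fun u x) (rank1_fun_is_linear u x).

Definition rank1 u x : 'End(V) := linfun (rank1_fun u x).

Lemma rank1E u x v : rank1 u x v = B v u *: x.
Proof. exact: lfunE. Qed.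

(** Dividing by [Q x] rather than by [B x x] keeps the formula meaningful in characteristic 2, where
    it gives an orthogonal transvection. *)
Definition reflection x : 'End(V) := (\1 - (Q x)^-1 *: rank1 x x)%VF.

Lemma reflectionE x v : reflection x v = v - ((Q x)^-1 * B v x) *: x.
Proof. by rewrite add_lfunE opp_lfunE scale_lfunE id_lfunE rank1E scalerA. Qed.

Lemma reflection_iso U x : x \in U -> Q x != 0 -> reflection x \in Iso Q U.
Proof.
move=> xU Qx; apply/IsoP; split=> [v|w /orthov_polarP wU]; rewrite reflectionE.
  by rewrite !qformE; field.
by rewrite wU // mulr0 scale0r subr0.
Qed.

(** Equality of [Q u] and [Q u'] gives [B u (u - u') = Q (u - u')], so the reflection subtracts
    exactly [u - u'] from [u]. *)
Lemma reflection_swap u u' : Q u = Q u' -> Q (u - u') != 0 ->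
  reflection (u - u') u = u'.
Proof.
move=> Quu' Qx; rewrite reflectionE.
have -> : B u (u - u') = Q (u - u') by rewrite !qformE Quu'; ring.
by rewrite mulVf // scale1r opprB addrC subrK.
Qed.

(* The Eichler transformation, needed because no reflection exchanges two
   orthogonal singular vectors. *)
Definition siegel u x : 'End(V) :=
  (\1 + rank1 u x - rank1 x u - Q x *: rank1 u u)%VF.

Lemma siegelE u x v :
  siegel u x v = v + B v u *: x - B v x *: u - (Q x * B v u) *: u.
Proof.
by rewrite !(add_lfunE, opp_lfunE, scale_lfunE, id_lfunE, rank1E) scalerA.
Qed.

Lemma siegel_iso U u x :
    u \in U -> x \in U -> Q u = 0 -> B u x = 0 -> siegel u x \in Iso Q U.
Proof.
move=> uU xU Qu Bux; apply/IsoP; split=> [v|w /orthov_polarP wU]; rewrite siegelE.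
  by rewrite !qformE Qu (polarC _ x u) Bux; ring.
by rewrite !wU // mulr0 !scale0r addr0 !subr0.
Qed.

End Isometries.

(** * Equations over a finite field *)

Section FiniteFieldEquations.

Variable F : finFieldType.
Implicit Types a b c : F.

Lemma sqr_surj_char2 c : 2 = 0 :> F -> exists a, a ^+ 2 = c.
Proof.
move=> F2; have sqr_inj : injective (fun a : F => a ^+ 2).
  move=> a b /eqP; rewrite eqf_sqr => /orP[/eqP //|/eqP ->].
  by apply/eqP; rewrite -subr_eq0 -opprD oppr_eq0 -mulr2n -mulr_natl F2 mul0r.
by exists (invF sqr_inj c); apply: (f_invF sqr_inj).
Qed.

(** Squaring hits 0 once and every other square at most twice. *)
Lemma card_sqr_lt : (#|F| < 2 * #|[set a ^+ 2 | a : F]|)%N.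
Proof.
set A := [set a ^+ 2 | a : F].
have A0 : 0 \in A by apply/imsetP; exists 0; rewrite ?expr0n.
rewrite -cardsT -sum1_card (partition_big (fun a => a ^+ 2) (mem A)) /=; last first.
  by move=> a _; apply: imset_f.
rewrite (bigD1 0) //= (cardsD1 0 A) A0 mulnDr muln1.
rewrite (big_pred1 0) => [|a]; last by rewrite inE expf_eq0.
apply: (@leq_ltn_trans (1 + \sum_(s in A :\ 0) 2)); last first.
  by rewrite sum_nat_const mulnC ltn_add2r.
rewrite leq_add2l [leqRHS](eq_bigl (fun s => (s \in A) && (s != 0))) => [|s]; last first.
  by rewrite !inE andbC.
apply: leq_sum => s /andP[/imsetP[b _ ->] _].
rewrite sum1_card; apply: leq_trans (card_size [:: b; - b]).
by apply/subset_leq_card/subsetP => a; rewrite !inE unfold_in /= inE eqf_sqr.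
Qed.

(** Pigeonhole: the values [a * x ^+ 2] and the values [c - b * y ^+ 2] each fill more than half of
    the field, so they share an element. *)
Lemma diag_form_universal a b c :
  a != 0 -> b != 0 -> exists x y, a * x ^+ 2 + b * y ^+ 2 = c.
Proof.
move=> a0 b0; pose A := [set x ^+ 2 | x : F].
pose A1 := [set a * s | s in A]; pose A2 := [set c - b * s | s in A].
have cardA1 : #|A1| = #|A| by rewrite card_imset //; apply: mulfI.
have cardA2 : #|A2| = #|A|.
  by rewrite card_imset // => s t /addrI/oppr_inj/(mulfI b0).
have : A1 :&: A2 != set0.
  apply/eqP => cap0; have := subset_leq_card (subsetT (A1 :|: A2)).
  rewrite cardsT cardsU cap0 cards0 cardA1 cardA2 subn0 addnn -mul2n.
  by rewrite leqNgt card_sqr_lt.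
case/set0Pn => s; rewrite inE => /andP[/imsetP[_ /imsetP[x _ ->] ->]].
case/imsetP => _ /imsetP[y _ ->] eq; exists x, y; by rewrite eq subrK.
Qed.

Lemma card_mulf_eq c :
  #|[set p : F * F | p.1 * p.2 == c]| = ((c == 0%R) * #|F| + #|F|.-1)%N.
Proof.
rewrite -sum1dep_card (eq_bigl (fun p : F * F => predT p.1 && (p.1 * p.2 == c))) //.
rewrite -(pair_big_dep predT (fun a b => a * b == c) (fun _ _ => 1%N)) /=.
rewrite (bigD1 0) //=; congr (_ + _)%N.
  case: eqP => [->|/eqP c0]; last by rewrite big1 // => b; rewrite mul0r eq_sym (negPf c0).
  by rewrite (eq_bigl predT) => [|b]; rewrite ?mul0r ?eqxx // sum1_card mul1n.
rewrite -(cardC1 (0 : F)) -sum1_card.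
apply: eq_big => [a|a a0]; first by rewrite !inE.
rewrite (big_pred1 (a^-1 * c)) // => b /=.
by apply/eqP/eqP => [<-|->]; rewrite ?mulKf ?mulVKf.
Qed.

(** Each [t] in [R] contributes the solutions of [a * b = - g t]. The general [T] and [g] serve both
    for subspaces of [V] and for forms on matrices. *)
Lemma card_hyperbolic_zeros (T : finType) (R : {set T}) (g : T -> F) :
  #|[set p : F * F * T | (p.2 \in R) && (p.1.1 * p.1.2 + g p.2 == 0)]| =
  (#|F| * #|[set t in R | g t == 0%R]| + #|F|.-1 * #|R|)%N.
Proof.
rewrite -[LHS]sum1dep_card.
rewrite (partition_big (fun p : F * F * T => p.2) (mem R)) /=; last by move=> p /andP[].
transitivity (\sum_(t in R) ((g t == 0%R) * #|F| + #|F|.-1))%N.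
  apply: eq_bigr => t tR; rewrite -oppr_eq0 -card_mulf_eq.
  have pair_inj : injective (fun p : F * F => (p, t)) by move=> p1 p2 [].
  rewrite sum1_card -[RHS](card_imset _ pair_inj); apply: eq_card => -[p s].
  rewrite unfold_in /=; apply/andP/imsetP => [[/andP[_ /eqP e] /eqP st]|[p' + [-> ->]]].
    by exists p; rewrite -st // inE -addr_eq0 e.
  by rewrite inE => /eqP e; rewrite /= tR e addNr !eqxx.
rewrite big_split /= sum_nat_const mulnC; congr (_ + _)%N.
rewrite -big_distrl /= mulnC; congr (_ * _)%N.
by rewrite -sum1dep_card big_mkcondr /=; apply: eq_bigr => t _; case: eqP.
Qed.

End FiniteFieldEquations.

Lemma card_mem_vspace (F : finFieldType) (V : vectType F) (U : {vspace V}) :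
  #|[set v : finvect_type V | v \in U]| = (#|F| ^ \dim U)%N.
Proof.
pose h (c : 'rV[F]_(\dim U)) : finvect_type V := \sum_i c 0 i *: (vbasis U)`_i.
have freeU : free (vbasis U) := basis_free (vbasisP U).
have h_inj : injective h.
  move=> c c' eqh; apply/rowP => i.
  by rewrite -[LHS](coord_sum_free (c 0) i freeU)
    -[RHS](coord_sum_free (c' 0) i freeU) -/(h c) eqh.
rewrite -[in RHS](mul1n (\dim U)) -card_mx -[RHS](card_imset predT h_inj).
apply: eq_card => v; rewrite inE; apply/idP/imsetP => [/coord_vbasis vE|[c _ ->]].
  by exists (\row_i coord (vbasis U) i v); rewrite // [LHS]vE;
    apply: eq_bigr => i _; rewrite mxE.
by apply: rpred_sum => i _; rewrite rpredZ // vbasis_mem // mem_nth // size_tuple.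
Qed.

(** * Hyperbolic pairs and the recursion step *)

Section HyperbolicPairs.

Variables (F : finFieldType) (V : vectType F) (Q : quadform V).
Local Notation B := (polar Q).
Local Notation q := #|F|.
Implicit Types (u v w x y : V) (a : F) (U W : {vspace V}) (f g : 'End(V)).

(** This is triviality of the radical of [Q] on [U]: by [qformD], a vector of [U] lies in that
    radical exactly when it is singular and orthogonal to [U]. *)
Definition nondeg_on U :=
  forall v, v \in U -> v \in orthov B U -> Q v = 0 -> v = 0.

Definition singular_set U : {set finvect_type V} :=
  [set v : finvect_type V | (v \in U) && (Q v == 0)].

Definition hyperbolic_pair u v := [/\ Q u = 0, Q v = 0 & B u v = 1].

Lemma exists_hyperbolic_partner U u :
    nondeg_on U -> u \in U -> u != 0 -> Q u = 0 ->
  exists2 v, v \in U & hyperbolic_pair u v.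
Proof.
move=> ndU uU u0 Qu.
have : u \notin orthov B U by apply: contraNN u0 => uo; rewrite (ndU u).
case/orthov_polarPn => w wU Buw.
have [w1 w1U Buw1] : exists2 w1, w1 \in U & B u w1 = 1.
  by exists ((B u w)^-1 *: w); rewrite ?rpredZ // polarZr mulVf.
(* Subtracting [Q w1 *: u] makes [w1] singular and keeps its product with [u], since [B u u = 0]. *)
exists (w1 - Q w1 *: u); first by rewrite rpredB ?rpredZ.
by split=> //; rewrite !qformE ?(polarC _ w1 u) Qu Buw1; ring.
Qed.

Definition residue U u v := (U :&: orthov B <[u]> :&: orthov B <[v]>)%VS.

Lemma mem_residue U u v w :
  (w \in residue U u v) = [&& w \in U, B w u == 0 & B w v == 0].
Proof. by rewrite !memv_cap !mem_orthov1_polar andbA. Qed.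

Section Residue.

Variables (U : {vspace V}) (u v : V).
Hypotheses (uU : u \in U) (vU : v \in U) (uv : hyperbolic_pair u v).

Lemma polar_uu : B u u = 0.
Proof. by case: uv => Qu _ _; rewrite polarxx Qu mulr0. Qed.

Lemma polar_vv : B v v = 0.
Proof. by case: uv => _ Qv _; rewrite polarxx Qv mulr0. Qed.

Lemma polar_vu : B v u = 1.
Proof. by case: uv; rewrite polarC. Qed.

(** Both intersections are proper: [v] in [U] is not orthogonal to [u], and [u], which lies in its
    own complement, is not orthogonal to [v]. *)
Lemma dim_residue : (\dim (residue U u v)).+2 = \dim U.
Proof.
have [_ _ Buv] := uv.
have u_notin : u \notin orthov B U.
  by apply/orthov_polarPn; exists v; rewrite // Buv oner_neq0.
have v_notin : v \notin orthov B (U :&: orthov B <[u]>)%VS.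
  apply/orthov_polarPn; exists u; first by rewrite memv_cap uU mem_orthov1_polar polar_uu eqxx.
  by rewrite polar_vu oner_neq0.
have u0 : u != 0 by apply: contraNneq u_notin => ->; rewrite mem0v.
have := eq_dim_orthov1 v_notin; have := eq_dim_orthov1 u_notin.
(* The dimension drops are stated with truncated predecessors, so positivity is required to invert
   them. *)
have : (0 < \dim (U :&: orthov B <[u]>))%N.
  rewrite lt0n dimv_eq0 -subv0; apply: contra u0 => /subvP/(_ u).
  by rewrite memv_cap uU mem_orthov1_polar polar_uu eqxx memv0 => /(_ isT).
rewrite -/(residue U u v); move: (\dim U) (\dim (_ :&: _)) (\dim _) => m n p; lia.
Qed.

(** Coordinates for the splitting of [U] into the hyperbolic plane and the residue. The coefficient
    of [u] is the product with [v], and conversely. *)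
Definition residue_sum a b w := a *: u + b *: v + w.

Definition residue_proj x := x - B x v *: u - B x u *: v.

Lemma residue_decomposition x : x = residue_sum (B x v) (B x u) (residue_proj x).
Proof. by rewrite /residue_sum [RHS]addrC /residue_proj -[x - _ - _]addrA -opprD subrK. Qed.

Lemma residue_proj_mem x : x \in U -> residue_proj x \in residue U u v.
Proof.
move=> xU; have [_ _ Buv] := uv; rewrite mem_residue !rpredB ?rpredZ //=.
by rewrite !polarE polar_uu polar_vv polar_vu Buv; apply/andP; split; apply/eqP; ring.
Qed.

Lemma qform_residue_sum a b w : w \in residue U u v ->
  Q (residue_sum a b w) = a * b + Q w.
Proof.
rewrite mem_residue => /and3P[_ /eqP Bwu /eqP Bwv]; have [Qu Qv Buv] := uv.
by rewrite /residue_sum !qformE !(polarC _ _ w) Bwu Bwv Buv Qu Qv; ring.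
Qed.

Lemma residue_sum_coords a b w : w \in residue U u v ->
  let x := residue_sum a b w in
  [/\ x \in U, B x v = a, B x u = b & residue_proj x = w].
Proof.
rewrite mem_residue => /and3P[wU /eqP Bwu /eqP Bwv] x; have [Qu Qv Buv] := uv.
have xv : B x v = a by rewrite /x /residue_sum !polarE Bwv polar_vv Buv; ring.
have xu : B x u = b by rewrite /x /residue_sum !polarE Bwu polar_uu polar_vu; ring.
split=> //; first by rewrite !rpredD ?rpredZ.
by apply/eqP; rewrite /residue_proj xv xu !subr_eq /x /residue_sum addrC (addrC (a *: u)) addrA.
Qed.

(** Any [x] in [U] differs from its projection by a combination of [u] and [v], so a vector of the
    residue orthogonal to the residue is orthogonal to all of [U]. *)
Lemma residue_nondeg : nondeg_on U -> nondeg_on (residue U u v).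
Proof.
move=> ndU w wR /orthov_polarP w_orth Qw.
have := wR; rewrite mem_residue => /and3P[wU /eqP Bwu /eqP Bwv].
apply: ndU => //; apply/orthov_polarP => x xU.
have := w_orth _ (residue_proj_mem xU).
by rewrite /residue_proj !polarE Bwu Bwv !mulr0 !subr0.
Qed.

Lemma card_singular_residue :
  #|singular_set U| = (q * #|singular_set (residue U u v)| +
                       q.-1 * q ^ \dim (residue U u v))%N.
Proof.
pose R := [set w : finvect_type V | w \in residue U u v].
pose h (p : F * F * finvect_type V) : finvect_type V :=
  residue_sum p.1.1 p.1.2 p.2.
rewrite -card_mem_vspace -/R.
have -> : #|singular_set (residue U u v)| = #|[set w in R | (Q : finvect_type V -> F) w == 0]|.
  by apply: eq_card => w; rewrite !inE.
rewrite -card_hyperbolic_zeros.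
rewrite -(card_in_imset (f := h)) => [|[[a b] w] [[a' b'] w']]; last first.
  rewrite !inE /= => /andP[wR _] /andP[wR' _] eqh.
  have {}eqh : residue_sum a b w = residue_sum a' b' w' := eqh.
  have [_ ea eb ew] := residue_sum_coords a b wR.
  have [_ ea' eb' ew'] := residue_sum_coords a' b' wR'.
  by move: ea eb ew; rewrite eqh ea' eb' ew' => -> -> ->.
apply: eq_card => x; apply/idP/imsetP => [|[[[a b] w]]]; rewrite !inE.
  case/andP => xU /eqP Qx.
  have xR := residue_proj_mem xU.
  have ex := residue_decomposition x.
  exists (B x v, B x u, residue_proj x) => //.
  by rewrite !inE /= xR -qform_residue_sum // -ex Qx eqxx.
case/andP=> /= wR /eqP Qw ->; rewrite /h /= qform_residue_sum // Qw eqxx andbT.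
by have [] := residue_sum_coords a b wR.
Qed.

Lemma partner_decomposition x : x \in U -> B u x = 1 -> Q x = 0 ->
  x = residue_sum (- Q (residue_proj x)) 1 (residue_proj x).
Proof.
move=> xU Bux Qx; have := qform_residue_sum (B x v) (B x u) (residue_proj_mem xU).
rewrite -residue_decomposition Qx [B x u]polarC Bux mulr1 => /eqP.
rewrite eq_sym addr_eq0 => /eqP <-; rewrite -Bux (polarC _ u).
exact: residue_decomposition.
Qed.

(** The residue component of a partner is arbitrary; it determines the coefficient of [u], while the
    coefficient of [v] is 1. *)
Lemma card_partners :
  #|[set x : finvect_type V | [&& x \in U, B u x == 1 & Q x == 0]]| =
  (q ^ \dim (residue U u v))%N.
Proof.
rewrite -card_mem_vspace.
pose h (w : finvect_type V) : finvect_type V :=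
    residue_sum (- Q w) 1 w.
rewrite -[RHS](card_in_imset (f := h)) => [|w w']; last first.
  rewrite !inE => wR wR' eqh.
  have [_ _ _ <-] := residue_sum_coords (- Q w) 1 wR.
  have [_ _ _ <-] := residue_sum_coords (- Q w') 1 wR'.
  by rewrite -/(h w) eqh.
apply: eq_card => x; apply/idP/imsetP => [|[w]]; rewrite !inE.
  case/and3P => xU /eqP Bux /eqP Qx.
  have xR := residue_proj_mem xU.
  by exists (residue_proj x); [rewrite inE | apply: partner_decomposition].
move=> wR ->; have [hU _ hu _] := residue_sum_coords (- Q w) 1 wR.
by rewrite /h hU polarC hu qform_residue_sum // mulr1 addNr !eqxx.
Qed.

End Residue.

Hypothesis nondegB : nondegenerate B.

Lemma reflection_moves_singular U u u' :
    u \in U -> u' \in U -> Q u = 0 -> Q u' = 0 -> B u u' != 0 ->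
  exists2 f, f \in Iso Q U & f u = u'.
Proof.
move=> uU u'U Qu Qu' Buu'.
have Qd : Q (u - u') != 0 by rewrite !qformE Qu Qu' !add0r oppr_eq0.
exists (reflection Q (u - u')); first by rewrite reflection_iso ?rpredB.
by rewrite reflection_swap // Qu Qu'.
Qed.

(** Orthogonal [u] and [u'] are joined by two reflections through a singular vector [w1] that is
    orthogonal to neither. *)
Lemma iso_transitive_singular U u u' : nondeg_on U ->
    u \in U -> u' \in U -> u != 0 -> u' != 0 -> Q u = 0 -> Q u' = 0 ->
  exists2 f, f \in Iso Q U & f u = u'.
Proof.
move=> ndU uU u'U u0 u'0 Qu Qu'.
have [Buu'|] := eqVneq (B u u') 0; last exact: reflection_moves_singular.
have [v vU [_ _ Buv]] := exists_hyperbolic_partner ndU uU u0 Qu.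
have [v' v'U [_ _ Bu'v']] := exists_hyperbolic_partner ndU u'U u'0 Qu'.
(* If neither [v] nor [v'] has nonzero product with both [u] and [u'], then [v + v'] does. *)
have [w wU /andP[Buw Bu'w]] : exists2 w, w \in U & (B u w != 0) && (B u' w != 0).
  have [Bu'v|Bu'v] := eqVneq (B u' v) 0; last by exists v; rewrite // Buv oner_neq0.
  have [Buv'|Buv'] := eqVneq (B u v') 0.
    exists (v + v'); first by rewrite rpredD.
    by rewrite !polarDr Buv Bu'v' Bu'v Buv' addr0 add0r oner_neq0.
  by exists v'; rewrite // Buv' Bu'v' oner_neq0.
(* The correction makes [w] singular; its products with [u] and [u'] do not change because [u] is
   orthogonal to both. *)
pose w1 := w - (Q w / B u w) *: u.
have w1U : w1 \in U by rewrite rpredB ?rpredZ.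
have Qw1 : Q w1 = 0 by rewrite !qformE (polarC _ w u) Qu; field.
have Buw1 : B u w1 = B u w by rewrite !polarE polarxx Qu; ring.
have Bu'w1 : B u' w1 = B u' w by rewrite !polarE (polarC _ u' u) Buu'; ring.
have [f fI fu] : exists2 f, f \in Iso Q U & f u = w1.
  by apply: reflection_moves_singular; rewrite ?Buw1.
have [g gI gw] : exists2 g, g \in Iso Q U & g w1 = u'.
  by apply: reflection_moves_singular; rewrite // polarC Bu'w1.
by exists (g \o f)%VF; [apply: iso_comp | rewrite comp_lfunE fu].
Qed.

Lemma iso_transitive_partners U u v x : u \in U -> v \in U -> x \in U ->
    hyperbolic_pair u v -> hyperbolic_pair u x ->
  exists2 f, f \in Iso Q (U :&: orthov B <[u]>) & f v = x.
Proof.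
move=> uU vU xU [Qu Qv Buv] [_ Qx Bux].
have Bud : B u (x - v) = 0 by rewrite !polarE Bux Buv subrr.
exists (siegel Q u (x - v)).
  rewrite iso_stab // siegel_iso ?rpredB //= siegelE polarxx Bud Qu !mulr0.
  by rewrite !scale0r addr0 !subr0.
rewrite siegelE (polarC _ v u) Buv scale1r mulr1 -addrA -opprD -scalerDl.
(* The multiple of [u] left in the image of [v] vanishes because [v] and [x] are singular. *)
have -> : B v (x - v) + Q (x - v) = 0 by rewrite !qformE (polarC _ v x) Qx Qv; ring.
by rewrite scale0r subr0 addrC subrK.
Qed.

(** Two orbit counts: [u] runs over the nonzero singular vectors of [U], then [v] over the partners
    of the fixed [u]. *)
Lemma card_iso_residue U u v :
    nondeg_on U -> u \in U -> v \in U -> hyperbolic_pair u v ->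
  #|Iso Q U| = (#|singular_set U|.-1 *
                (q ^ \dim (residue U u v) * #|Iso Q (residue U u v)|))%N.
Proof.
move=> ndU uU vU uv; have [Qu Qv Buv] := uv.
have nz f : f \in Iso Q U -> f u != 0.
  move=> fI; apply: contra_neq (oner_neq0 F) => fu0.
  by rewrite -Buv -(iso_polar u v fI) fu0 polar0l.
have u0 : u != 0 by apply: contra_neq (oner_neq0 F) => u0; rewrite -Buv u0 polar0l.
pose z : finvect_type V := (0 : V).
rewrite (card_iso_orbit nondegB (u := u) (S := singular_set U :\ z)).
- congr (_ * _)%N; first by rewrite (cardsD1 z (singular_set U)) inE
    [z \in U]mem0v [Q z]qform0 eqxx.
  rewrite -(card_partners uU vU uv).
  apply: card_iso_orbit => //= [f|x].
    rewrite iso_stab // => /andP[fI /eqP fu].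
    rewrite inE (iso_stable nondegB fI vU) -{1}fu (iso_polar _ _ fI) Buv.
    by case/IsoP: fI => Qf _; rewrite Qf Qv !eqxx.
  rewrite inE => /and3P[xU /eqP Bux /eqP Qx].
  exact: iso_transitive_partners.
- move=> f fI; rewrite !inE nz // (iso_stable nondegB fI uU) /=.
  by case/IsoP: fI => Qf _; rewrite Qf Qu.
move=> u'; rewrite !inE => /and3P[u'0 u'U /eqP Qu'].
exact: iso_transitive_singular.
Qed.

End HyperbolicPairs.

(** * Existence of singular vectors; lines and anisotropic planes *)

Section SmallDimensions.

Variables (F : finFieldType) (V : vectType F) (Q : quadform V).
Local Notation B := (polar Q).
Local Notation q := #|F|.
Implicit Types (u v w x y : V) (a c : F) (U W : {vspace V}) (f g : 'End(V)).

Lemma exists_neq0 W : (0 < \dim W)%N -> exists2 w, w \in W & w != 0.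
Proof.
by move=> dW; exists (vpick W); rewrite ?memv_pick // vpick0 -dimv_eq0 -lt0n.
Qed.

Lemma exists_notin_line W u : (1 < \dim W)%N -> exists2 w, w \in W & w \notin <[u]>%VS.
Proof.
move=> dW; apply/subvPn; apply: contraL dW => /dimvS; rewrite dim_vline -leqNgt => le1.
exact: leq_trans le1 (leq_b1 _).
Qed.

(** Orthogonal vectors turn [Q] into a diagonal form. Two suffice in characteristic 2, where every
    element is a square; otherwise three are used with [diag_form_universal]. *)
Lemma exists_singular U :
  (2 < \dim U)%N -> exists u, [/\ u \in U, u != 0 & Q u = 0].
Proof.
move=> dU; have [u uU u0] : exists2 u, u \in U & u != 0 by apply: exists_neq0; lia.
have [Qu|Qu] := eqVneq (Q u) 0; first by exists u.
have dU1 := leq_dim_orthov1 B u U.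
have [|w] := @exists_notin_line (U :&: orthov B <[u]>)%VS u.
  by apply: leq_trans dU1; move: (\dim U) dU => n; lia.
rewrite memv_cap mem_orthov1_polar => /andP[wU /eqP Bwu] wu.
have w0 : w != 0 by apply: contraNneq wu => ->; rewrite mem0v.
have [Qw|Qw] := eqVneq (Q w) 0; first by exists w.
have [F2|F2] := eqVneq (2 : F) 0.
  have [a a2] := sqr_surj_char2 (Q w / Q u) F2.
  exists (a *: u + w); split; first by rewrite rpredD ?rpredZ.
    apply: contraNneq wu => /eqP; rewrite addrC addr_eq0 => /eqP ->.
    by rewrite rpredN rpredZ ?memv_line.
  rewrite !qformE (polarC _ u) Bwu a2 divfK // mulr0 addr0.
  by rewrite -mulr2n -mulr_natl F2 mul0r.
have dU2 := leq_dim_orthov1 B w (U :&: orthov B <[u]>)%VS.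
have [|w'] := @exists_neq0 (U :&: orthov B <[u]> :&: orthov B <[w]>)%VS.
  apply: leq_trans dU2; move: dU1.
  by move: (\dim U) (\dim (_ :&: _)) dU => m n; lia.
rewrite !memv_cap !mem_orthov1_polar => /andP[/andP[w'U /eqP Bw'u] /eqP Bw'w] w'0.
have [Qw'|Qw'] := eqVneq (Q w') 0; first by exists w'.
have [a [b eab]] := diag_form_universal (- Q w') Qu Qw.
exists (a *: u + b *: w + w'); split; first by rewrite !rpredD ?rpredZ.
  (* The product of this vector with [w'] is [2 * Q w'], which is nonzero here. *)
  apply: contra_neq Qw' => x0; apply: (mulfI F2); rewrite -polarxx mulr0.
  by rewrite -[RHS](polar0r Q w') -x0 !polarE Bw'u Bw'w !mulr0 !add0r.
rewrite !qformE !(polarC _ _ w') (polarC _ u w) Bwu Bw'u Bw'w !mulr0 !addr0.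
by rewrite ![_ ^+ 2 * _]mulrC eab addNr.
Qed.

Hypothesis nondegB : nondegenerate B.

Lemma card_iso0 : #|Iso Q 0%VS| = 1%N.
Proof.
have -> : Iso Q 0%VS = [set (\1%VF : finvect_type 'End(V))].
  apply/setP => f; rewrite in_set1; apply/(IsoP Q 0%VS f)/eqP => [[_ f1]|->].
    by apply/lfunP => v; rewrite id_lfunE f1 // orthov0 memvf.
  by split=> [v|w _]; rewrite id_lfunE.
by rewrite cards1.
Qed.

(** Choose [y] with [B y x = 1]. Then [V] is spanned by [y] and the complement of [x], which [f]
    fixes, so [f] is determined by [f y]. *)
Lemma iso_line x f : Q x != 0 -> f \in Iso Q <[x]>%VS -> f = \1%VF \/ f = reflection Q x.
Proof.
move=> Qx fI; have [Qf fix_perp] := IsoP _ _ _ fI.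
have x0 : x != 0 by apply: contraNneq Qx => ->; rewrite qform0.
have [y Byx] : exists y, B y x = 1.
  have : x \notin orthov B fullv by rewrite (eqP nondegB) memv0.
  case/orthov_polarPn => y _ Bxy; exists ((B x y)^-1 *: y).
  by rewrite polarZl (polarC _ y) mulVf.
have f_ext g : {in orthov B <[x]>%VS, forall w, g w = w} -> f y = g y -> f = g.
  move=> g_perp fgy; apply/lfunP => v.
  have vP : v - B v x *: y \in orthov B <[x]>%VS.
    by rewrite mem_orthov1_polar !polarE Byx mulr1 subrr.
  by rewrite -[v](subrK (B v x *: y)) (linearD f) (linearD g) /=
    (fix_perp _ vP) (g_perp _ vP) !linearZ /= fgy.
have /vlineP[c fyc] : f y - y \in <[x]>%VS.
  rewrite -(orthovK nondegB <[x]>); apply/orthov_polarP => w wP.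
  by rewrite !polarE -{1}(fix_perp w wP) (iso_polar _ _ fI) subrr.
have {}fyc : f y = y + c *: x by rewrite -fyc addrC subrK.
(* Preservation of [Q] at [y] reads [c * (c * Q x + 1) = 0]; the two roots give the identity and the
   reflection. *)
have := Qf y; rewrite fyc !qformE Byx mulr1 -addrA => /eqP.
rewrite addrC -subr_eq0 addrK expr2 -mulrA -[X in _ + X]mulr1 -mulrDr mulf_eq0.
case/orP => [/eqP c0|/eqP c1].
  left; apply: f_ext => [w _|]; rewrite id_lfunE // fyc c0 scale0r addr0.
  by [].
right; apply: f_ext => [w|]; rewrite reflectionE.
  by rewrite mem_orthov1_polar => /eqP ->; rewrite mulr0 scale0r subr0.
rewrite fyc Byx mulr1 -scaleNr; congr (_ + _ *: _).
by apply: (mulIf Qx); rewrite mulNr mulVf //; apply/eqP; rewrite -addr_eq0 c1.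
Qed.

Lemma card_iso_line x : Q x != 0 -> #|Iso Q <[x]>%VS| = 2%N.
Proof.
move=> Qx; have x0 : x != 0 by apply: contraNneq Qx => ->; rewrite qform0.
have -> : Iso Q <[x]>%VS =
    [set (\1%VF : finvect_type 'End(V)); (reflection Q x : finvect_type 'End(V))].
  apply/setP => f; rewrite in_set2; apply/idP/orP => [/(iso_line Qx)[]->|[]/eqP ->].
  - by left.
  - by right.
  - by apply/IsoP; split=> [v|w _]; rewrite id_lfunE.
  - by apply: reflection_iso; rewrite ?memv_line.
rewrite cards2; suff -> : (\1%VF : finvect_type 'End(V)) != reflection Q x by [].
(* In characteristic 2 the reflection fixes [x], so it is told from the identity at some [y] in [V]
   not orthogonal to [x]. *)
have : x \notin orthov B fullv by rewrite (eqP nondegB) memv0.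
case/orthov_polarPn => y _; rewrite polarC => Byx.
apply: contraNneq Byx => /lfunP/(_ y); rewrite id_lfunE reflectionE => /eqP.
rewrite -subr_eq0 opprB addrC subrK scaler_eq0 (negPf x0) orbF mulf_eq0 invr_eq0.
by rewrite (negPf Qx).
Qed.

Lemma dim1_line U x : \dim U = 1%N -> x \in U -> x != 0 -> U = <[x]>%VS.
Proof.
move=> dU xU x0; apply/eqP; rewrite eq_sym eqEdim -memvE xU dU dim_vline x0.
by [].
Qed.

Lemma nondeg_line U : nondeg_on Q U -> \dim U = 1%N ->
  exists2 x, Q x != 0 & U = <[x]>%VS.
Proof.
move=> ndU dU; have [|x xU x0] := @exists_neq0 U; first by rewrite dU.
have eU := dim1_line dU xU x0; exists x => //.
apply: contra_neq x0 => Qx; apply: ndU => //.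
by rewrite eU mem_orthov1_polar polarxx Qx mulr0.
Qed.

Lemma singular_set0 U : {in U, forall v, Q v = 0 -> v = 0} ->
  #|singular_set Q U| = 1%N.
Proof.
move=> anisoU; pose z : finvect_type V := (0 : V).
rewrite -(cards1 z); apply: eq_card => v; rewrite in_set1 inE.
apply/andP/eqP => [[vU /eqP Qv]|->]; first exact: anisoU.
by rewrite [z \in U]mem0v [Q z]qform0.
Qed.

Lemma card_singular_dim1 U : nondeg_on Q U -> \dim U = 1%N ->
  #|singular_set Q U| = 1%N.
Proof.
move=> ndU /(nondeg_line ndU)[x Qx ->]; apply: singular_set0 => _ /vlineP[a ->] /eqP.
by rewrite qformZ mulf_eq0 (negPf Qx) orbF expf_eq0 /= => /eqP ->; rewrite scale0r.
Qed.

Lemma card_iso_dim1 U : nondeg_on Q U -> \dim U = 1%N -> #|Iso Q U| = 2%N.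
Proof. by move=> ndU /(nondeg_line ndU)[x Qx ->]; apply: card_iso_line. Qed.

Section AnisotropicPlane.

Variable U : {vspace V}.
Hypotheses (dimU : \dim U = 2%N) (anisoU : {in U, forall v, Q v = 0 -> v = 0}).

Lemma aniso_qform_neq0 u : u \in U -> u != 0 -> Q u != 0.
Proof. by move=> uU; apply: contra_neq; apply: anisoU. Qed.

(** In characteristic 2 one has [B u u = 0], so a [w] off the line of [u] is used: were it
    orthogonal to [u], some [a *: u + w] would be singular. *)
Lemma aniso_notin_orthov u : u \in U -> u != 0 -> u \notin orthov B U.
Proof.
move=> uU u0; have Qu := aniso_qform_neq0 uU u0.
have [F2|F2] := eqVneq (2 : F) 0; last first.
  by apply/orthov_polarPn; exists u => //; rewrite polarxx mulf_neq0.
have [|w wU wu] := @exists_notin_line U u; first by rewrite dimU.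
have [a a2] := sqr_surj_char2 (Q w / Q u) F2.
apply/orthov_polarPn; exists w => //; apply: contraNneq wu => Buw.
have /eqP : a *: u + w = 0.
  apply: anisoU; first by rewrite rpredD ?rpredZ.
  rewrite !qformE Buw a2 divfK // mulr0 addr0.
  by rewrite -mulr2n -mulr_natl F2 mul0r.
by rewrite addrC addr_eq0 => /eqP ->; rewrite rpredN rpredZ ?memv_line.
Qed.

Lemma dim_aniso_perp u : u \in U -> u != 0 -> \dim (U :&: orthov B <[u]>) = 1%N.
Proof. by move=> uU u0; rewrite -eq_dim_orthov1 ?dimU // aniso_notin_orthov. Qed.

Lemma aniso_universal c : exists2 u, u \in U & Q u = c.
Proof.
have [|u uU u0] := @exists_neq0 U; first by rewrite dimU.
have Qu := aniso_qform_neq0 uU u0.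
have [F2|F2] := eqVneq (2 : F) 0.
  have [a a2] := sqr_surj_char2 (c / Q u) F2.
  by exists (a *: u); rewrite ?rpredZ // qformZ a2 divfK.
have [|w] := @exists_neq0 (U :&: orthov B <[u]>)%VS; first by rewrite dim_aniso_perp.
rewrite memv_cap mem_orthov1_polar => /andP[wU /eqP Bwu] w0.
have [a [b eab]] := diag_form_universal c Qu (aniso_qform_neq0 wU w0).
exists (a *: u + b *: w); first by rewrite rpredD ?rpredZ.
by rewrite !qformE polarC Bwu !mulr0 addr0 ![_ ^+ 2 * _]mulrC.
Qed.

Definition level_set c : {set finvect_type V} :=
  [set v : finvect_type V | (v \in U) && (Q v == c)].

(** Two distinct vectors of a level set have a nonsingular difference, whose reflection exchanges
    them. The stabiliser belongs to a line and has order 2. *)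
Lemma card_iso_level_set c : c != 0 -> #|Iso Q U| = (#|level_set c| * 2)%N.
Proof.
move=> c0; have [u uU Quc] := aniso_universal c.
have u0 : u != 0 by apply: contra_neq c0 => u0; rewrite -Quc u0 qform0.
have -> : 2%N = #|Iso Q (U :&: orthov B <[u]>)|.
  rewrite card_iso_dim1 ?dim_aniso_perp // => v.
  by rewrite memv_cap => /andP[vU _] _; apply: anisoU.
apply: card_iso_orbit => //= [f fI|u'].
  by rewrite inE (iso_stable nondegB fI uU); case/IsoP: fI => -> _; rewrite Quc eqxx.
rewrite inE => /andP[u'U /eqP Qu'].
have [e|d0] := eqVneq (u - u') 0.
  have -> : u' = u by apply/esym/eqP; rewrite -subr_eq0 e.
  by exists \1%VF; [apply/IsoP; split=> [v|w _]; rewrite id_lfunE | rewrite id_lfunE].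
have dU : u - u' \in U by rewrite rpredB.
exists (reflection Q (u - u')).
  by apply: reflection_iso; rewrite ?aniso_qform_neq0.
by apply: reflection_swap; rewrite ?aniso_qform_neq0 // Quc Qu'.
Qed.

(* The q - 1 nonzero level sets partition the q ^ 2 - 1 nonzero vectors and, by
   the orbit count, all have |Iso| / 2 elements. *)
Lemma card_iso_aniso_plane : #|Iso Q U| = (2 * (q + 1))%N.
Proof.
have level0 : #|level_set 0| = 1%N by apply: singular_set0.
have : (\sum_c #|level_set c| = q ^ 2)%N.
  rewrite -dimU -card_mem_vspace -sum1_card.
  rewrite (partition_big (fun v : finvect_type V => Q v) predT) //=.
  apply: eq_bigr => c _; rewrite -sum1_card; apply: eq_bigl => v.
  by rewrite !inE.
rewrite (bigD1 0) //= level0 => e.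
have : (\sum_(c | c != 0%R) #|level_set c| * 2 = q.-1 * #|Iso Q U|)%N.
  rewrite -(cardC1 (0 : F)) -sum_nat_const; apply: eq_big => [c|c c0].
    by rewrite !inE.
  by rewrite -card_iso_level_set.
rewrite -big_distrl /=.
have q1 := finRing_gt1 F; move: e q1.
move: (\sum_(c | _) _)%N #|Iso Q U| q => s n r e r1 e2.
apply/eqP; rewrite -(eqn_pmul2l (m := r.-1)); last by lia.
rewrite -e2; apply/eqP; nia.
Qed.

End AnisotropicPlane.

End SmallDimensions.

(** * Zeros of the standard forms of both types *)

Section TypeCounts.

Variable F : finFieldType.
Local Notation q := #|F|.

Lemma PoszX (m n : nat) : (m ^ n)%:Z = m%:Z ^+ n.
Proof. by rewrite -!natz natrX. Qed.

Lemma ord2_ind (P : 'I_2 -> Prop) : P 0 -> P 1 -> forall i, P i.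
Proof.
by move=> P0 P1 [[|[|//]] lti]; [move: P0 | move: P1]; congr P; apply: val_inj.
Qed.

(** The first row is a hyperbolic plane that splits off; this is the coordinate counterpart of
    [card_singular_residue]. *)
Lemma card_matrix_zeros (k : nat) (g : 'M[F]_(k, 2) -> F) (f : 'M[F]_(1 + k, 2) -> F) :
    (forall x, f x = x 0 0 * x 0 1 + g (dsubmx x)) ->
  #|[set x | f x == 0]| = (q * #|[set y | g y == 0%R]| + q.-1 * q ^ (2 * k))%N.
Proof.
move=> fE; have -> : (q ^ (2 * k) = #|[set: 'M[F]_(k, 2)]|)%N.
  by rewrite cardsT card_mx mulnC.
have -> : [set y | g y == 0] = [set y in [set: 'M[F]_(k, 2)] | g y == 0].
  by apply/setP => y; rewrite !inE.
rewrite -card_hyperbolic_zeros.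
pose h (x : 'M[F]_(1 + k, 2)) := (x 0 0, x 0 1, dsubmx x).
have l0 : lshift k (0 : 'I_1) = (0 : 'I_(1 + k)) by apply: val_inj.
have h_inj : injective h.
  move=> x y [e0 e1 ed]; rewrite -[x]vsubmxK -[y]vsubmxK ed; congr (col_mx _ _).
  by apply/rowP; apply: ord2_ind; rewrite !mxE l0.
rewrite -(card_imset _ h_inj); apply: eq_card => -[[a b] y].
apply/imsetP/idP => [[x + ->]|]; rewrite !inE /= ?fE // => eq0.
pose x : 'M[F]_(1 + k, 2) := col_mx (\row_j (if j == 0 then a else b)) y.
have x0 j : x 0 j = if j == 0 then a else b.
  by rewrite -l0 col_mxEu mxE.
exists x; rewrite ?inE ?fE /h !x0 /= /x col_mxKd //.
Qed.

(* Multiplied by q so that k = 0 is included without the exponent 2k - 1. *)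
Lemma card_plus_form_zeros k :
  q%:Z * #|[set x | @plus_form F k x == 0]|%:Z = q%:Z ^+ (2 * k) + (q%:Z - 1) * q%:Z ^+ k.
Proof.
have q_gt0 := ltnW (finRing_gt1 F).
elim: k => [|k IH].
  have -> : [set x | @plus_form F 0 x == 0] = setT.
    by apply/setP => x; rewrite !inE /plus_form big_ord0 eqxx.
  by rewrite cardsT card_mx; ring.
rewrite (@card_matrix_zeros k (@plus_form F k)) => [|x]; last first.
  rewrite /plus_form big_ord_recl; congr (_ + _); apply: eq_bigr => i _.
  by rewrite !mxE rshift1.
rewrite PoszD !PoszM IH PoszX -subn1 -subzn // mulnS !exprD !exprS.
ring.
Qed.

(** If [b] were nonzero, [a / b] would be a root of the polynomial that [minus_parameter] declares
    rootless. *)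
Lemma minus_plane_anisotropic (e a b : F) :
  minus_parameter e -> minus_plane e a b = 0 -> a = 0 /\ b = 0.
Proof.
rewrite /minus_parameter /minus_plane; case: odd => eP.
  have [->|b0 /eqP] := eqVneq b 0.
    by rewrite expr0n mulr0 subr0 => /eqP; rewrite expf_eq0 /= => /eqP.
  by rewrite subr_eq0 => /eqP eab; have := eP (a / b);
    rewrite expr_div_n eab mulfK ?expf_neq0 ?eqxx.
have [->|b0 eab] := eqVneq b 0.
  by rewrite expr0n !mulr0 !addr0 => /eqP; rewrite expf_eq0 /= => /eqP.
have /eqP[] := eP (a / b); apply: (mulIf (expf_neq0 2 b0)); rewrite mul0r -[RHS]eab.
by field.
Qed.

Lemma card_minus_form_zeros k (e : F) : minus_parameter e ->
  q%:Z * #|[set x | @minus_form F k e x == 0]|%:Z =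
  q%:Z ^+ (2 * k.+1) - (q%:Z - 1) * q%:Z ^+ k.+1.
Proof.
move=> eP; have q_gt0 := ltnW (finRing_gt1 F).
elim: k => [|k IH].
  have -> : [set x | @minus_form F 0 e x == 0] = [set 0].
    apply/setP => x; rewrite !inE /minus_form big1 => [|i]; last by rewrite ord1.
    rewrite add0r; apply/eqP/eqP => [/(minus_plane_anisotropic eP)[x0 x1]|->].
      have row0 (i : 'I_1) : i = ord_max by apply: val_inj; case: i => -[].
      by apply/matrixP => i; apply: ord2_ind; rewrite mxE (row0 i).
    by rewrite /minus_plane !mxE; case: odd; ring.
  by rewrite cards1; ring.
(* The anisotropic plane occupies the last row, so removing the first row leaves a form of the same
   shape. *)
rewrite (@card_matrix_zeros k.+1 (@minus_form F k e)) => [|x]; last first.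
  rewrite /minus_form big_mkcond big_ord_recl /= -addrA; congr (_ + (_ + _)).
    rewrite [RHS]big_mkcond; apply: eq_bigr => i _.
    by rewrite !mxE rshift1; congr (if ~~ _ then _ else _).
  have -> : (ord_max : 'I_(1 + k.+1)) = rshift 1 ord_max by apply: val_inj.
  by rewrite !mxE.
rewrite PoszD !PoszM IH PoszX -subn1 -subzn // !mulnS !exprD !exprS.
ring.
Qed.

End TypeCounts.

(** * Induction on the dimension and the group orders *)

Section IsoCounts.

Variables (F : finFieldType) (V : vectType F) (Q : quadform V).
Local Notation B := (polar Q).
Local Notation q := #|F|.
Implicit Types (U : {vspace V}) (k : nat) (eps : int).

Lemma nondeg_on_qres U : trivial_qrad (qres Q U) -> nondeg_on Q U.
Proof.
move=> trivU v vU /orthov_polarP v_orth Qv.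
suff : vsproj U v = 0 by rewrite -{2}(vsprojK vU) => ->; rewrite linear0.
apply: trivU => u; rewrite /= /qres_fun linearD /= vsprojK //.
by rewrite qformD Qv v_orth ?subvsP // add0r addr0.
Qed.

(** Zeros correspond under the isometry, and the dimension is read off from the number of vectors of
    [U]. *)
Lemma qisometric_card U k (R : 'M[F]_(k, 2) -> F) : qisometric (qres Q U) R ->
  #|singular_set Q U| = #|[set x | R x == 0]| /\ \dim U = (2 * k)%N.
Proof.
case=> f [[g fK gK] Rf].
pose h (x : 'M[F]_(k, 2)) : finvect_type V := vsval (g x).
have h_inj : injective h by move=> x y eqh; apply: (can_inj gK); apply: subvs_inj.
have hU x : h x \in U by apply: subvsP.
have Qh x : Q (h x) = R x by rewrite -[x in RHS]gK Rf.
have h_onto v : v \in U -> exists x, v = h x.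
  by move=> vU; exists (f (vsproj U v)); rewrite /h fK vsprojK.
split.
  rewrite -(card_imset _ h_inj); apply: eq_card => v.
  rewrite inE; apply/andP/imsetP => [[/h_onto[x ->] /eqP Qx]|[x + ->]].
    by exists x; rewrite // inE -Qh Qx.
  by rewrite inE -Qh hU.
apply/eqP; rewrite -(eqn_exp2l _ _ (finRing_gt1 F)) -card_mem_vspace mulnC -card_mx.
rewrite -(card_imset predT h_inj); apply/eqP/eq_card => v.
by rewrite inE; apply/idP/imsetP => [/h_onto[x ->]|[x _ ->]]; [exists x | apply: hU].
Qed.

Lemma card_singular_type U k eps : \dim U = (2 * k)%N -> has_type (qres Q U) eps ->
  q%:Z * #|singular_set Q U|%:Z = q%:Z ^+ (2 * k) + eps * (q%:Z - 1) * q%:Z ^+ k.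
Proof.
move=> dimU [_ [[-> [k' /qisometric_card[-> dimU']]]|
                     [-> [k' [e [eP /qisometric_card[-> dimU']]]]]]].
  (* The rank [k'] hidden in the type is identified with [k] by comparing dimensions. *)
  have -> : k = k' by lia.
  by rewrite card_plus_form_zeros mul1r.
have -> : k = k'.+1 by lia.
by rewrite (card_minus_form_zeros _ eP); ring.
Qed.

Hypothesis nondegB : nondegenerate B.

Lemma card_recursion U u v :
    nondeg_on Q U -> u \in U -> v \in U -> hyperbolic_pair Q u v ->
  let W := residue Q U u v in
  #|singular_set Q U|%:Z = q%:Z * #|singular_set Q W|%:Z + (q%:Z - 1) * q%:Z ^+ \dim W /\
  #|Iso Q U|%:Z = (#|singular_set Q U|%:Z - 1) * q%:Z ^+ \dim W * #|Iso Q W|%:Z.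
Proof.
move=> ndU uU vU uv W; have q_gt0 := ltnW (finRing_gt1 F).
have nsU := card_singular_residue uU vU uv; split.
  by rewrite nsU PoszD !PoszM PoszX -subn1 -subzn.
have [_ Qv _] := uv.
have nsU_gt0 : (0 < #|singular_set Q U|)%N.
  by apply/card_gt0P; exists v; rewrite inE vU Qv eqxx.
by rewrite (card_iso_residue nondegB ndU uU vU uv) !PoszM PoszX -subn1 -subzn // mulrA.
Qed.

Lemma exists_hyperbolic_pair U u : nondeg_on Q U -> u \in U -> u != 0 -> Q u = 0 ->
  exists v, [/\ v \in U, hyperbolic_pair Q u v, nondeg_on Q (residue Q U u v) &
                 (\dim (residue Q U u v)).+2 = \dim U].
Proof.
move=> ndU uU u0 Qu; have [v vU uv] := exists_hyperbolic_partner ndU uU u0 Qu.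
by exists v; split=> //; [apply: residue_nondeg | apply: dim_residue].
Qed.

(** Both counts go through one induction, since the orbit length [#|singular_set Q U| - 1] in the
    recursion supplies the new factor of the product. *)
Lemma card_iso_odd k U : nondeg_on Q U -> \dim U = (2 * k + 1)%N ->
  #|singular_set Q U|%:Z = q%:Z ^+ (2 * k) /\
  #|Iso Q U|%:Z = 2 * q%:Z ^+ (k ^ 2)%N * \prod_(1 <= i < k.+1) (q%:Z ^+ (2 * i)%N - 1).
Proof.
elim: k U => [|k IH] U ndU dimU.
  by rewrite big_geq // card_singular_dim1 ?card_iso_dim1.
have [|u [uU u0 Qu]] := @exists_singular _ _ Q U; first by lia.
have [v [vU uv ndW dimW]] := exists_hyperbolic_pair ndU uU u0 Qu.
have {}dimW : \dim (residue Q U u v) = (2 * k + 1)%N by lia.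
have [-> ->] := card_recursion ndU uU vU uv; have [-> ->] := IH _ ndW dimW.
rewrite dimW.
have -> : q%:Z * q%:Z ^+ (2 * k) + (q%:Z - 1) * q%:Z ^+ (2 * k + 1) = q%:Z ^+ (2 * k.+1).
  by rewrite mulnS !exprD; ring.
split=> //; rewrite (big_nat_recr k.+1) //=.
have -> : (k.+1 ^ 2 = k ^ 2 + (2 * k + 1))%N by lia.
rewrite [q%:Z ^+ (k ^ 2 + _)]exprD; ring.
Qed.

Lemma anisotropic_or_singular U :
  {in U, forall v, Q v = 0 -> v = 0} \/ exists u, [/\ u \in U, u != 0 & Q u = 0].
Proof.
case: (pickP (fun u : finvect_type V => [&& u \in U, (u : V) != 0 & Q u == 0])) => [u|none].
  by case/and3P => uU u0 /eqP Qu; right; exists u.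
left=> v vU Qv; apply/eqP/negPn; apply: contraFN (none v) => v0.
by rewrite vU v0 Qv eqxx.
Qed.

(** The type is replaced by the count of singular vectors it yields, because this count descends to
    the residue by [card_recursion] without classifying the residue. *)
Lemma card_iso_even k U eps : (eps == 1) || (eps == -1) ->
    nondeg_on Q U -> \dim U = (2 * k.+1)%N ->
    q%:Z * #|singular_set Q U|%:Z =
      q%:Z ^+ (2 * k.+1) + eps * (q%:Z - 1) * q%:Z ^+ k.+1 ->
  #|Iso Q U|%:Z =
    2 * q%:Z ^+ (k.+1 ^ 2 - k.+1)%N * (q%:Z ^+ k.+1 - eps) *
    \prod_(1 <= i < k.+1) (q%:Z ^+ (2 * i)%N - 1).
Proof.
move=> epsP; have q_gt1 := finRing_gt1 F.
have qZ0 : q%:Z != 0 by rewrite eqz_nat -lt0n ltnW.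
elim: k U => [|k IH] U ndU dimU nsU.
  have {}nsU : #|singular_set Q U|%:Z = q%:Z + eps * (q%:Z - 1).
    by apply: (mulfI qZ0); rewrite nsU; ring.
  rewrite big_geq // expr0 expr1 !mulr1.
  (* An anisotropic plane has a single singular vector, which forces [eps = -1]; any other has
     [2q - 1], which forces [eps = 1]. *)
  have [anisoU|[u [uU u0 Qu]]] := anisotropic_or_singular U.
    rewrite (card_iso_aniso_plane nondegB dimU anisoU).
    rewrite singular_set0 // in nsU; case/orP: epsP nsU => /eqP -> nsU;
      move: #|F| q_gt1 nsU => n; lia.
  have [v [vU uv ndW dimW]] := exists_hyperbolic_pair ndU uU u0 Qu.
  have {}dimW : \dim (residue Q U u v) = 0%N by lia.
  have [nsU' ->] := card_recursion ndU uU vU uv.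
  have /eqP W0 : residue Q U u v == 0%VS by rewrite -dimv_eq0 dimW.
  have nsW : #|singular_set Q (residue Q U u v)| = 1%N.
    by apply: singular_set0 => w; rewrite W0 memv0 => /eqP.
  rewrite dimW W0 card_iso0 nsU in nsU' *; rewrite W0 in nsW; rewrite nsW in nsU'.
  case/orP: epsP nsU' => /eqP -> nsU'; move: #|F| q_gt1 nsU' => n; lia.
have {}nsU : #|singular_set Q U|%:Z = q%:Z ^+ (2 * k.+1).+1 + eps * (q%:Z - 1) * q%:Z ^+ k.+1.
  apply: (mulfI qZ0); rewrite nsU (_ : (2 * k.+2 = (2 * k.+1).+2)%N); last by lia.
  by rewrite ![_ ^+ _.+2]exprS; ring.
have [|u [uU u0 Qu]] := @exists_singular _ _ Q U; first by lia.
have [v [vU uv ndW dimW]] := exists_hyperbolic_pair ndU uU u0 Qu.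
have {}dimW : \dim (residue Q U u v) = (2 * k.+1)%N by lia.
have [nsU' ->] := card_recursion ndU uU vU uv.
(* The recursion for singular vectors, solved for the residue, gives the count that [IH]
   requires. *)
rewrite (IH _ ndW dimW); last first.
  apply: (addIr ((q%:Z - 1) * q%:Z ^+ (2 * k.+1))).
  by rewrite -[in LHS]dimW -nsU' nsU exprS; ring.
rewrite nsU dimW (big_nat_recr k.+1) //=.
have -> : (k.+2 ^ 2 - k.+2 = (k.+1 ^ 2 - k.+1) + 2 * k.+1)%N by nia.
rewrite exprD mul2n -addnn exprS exprD [q%:Z ^+ k.+2]exprS.
(* With [n = k + 2] and [eps ^+ 2 = 1], the orbit length factors as [(q^n - eps) (q^(n-1) + eps)];
   the second factor times [q^(n-1) - eps] from [IH] is the new factor [q^(2(n-1)) - 1]. *)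
by case/orP: epsP => /eqP ->; ring.
Qed.

End IsoCounts.

Theorem corollary4p7 (F : finFieldType) (q : nat) (hq : #|F| = q)
    (V : vectType F) (Q : quadform V) (hQ : nondegenerate (polar Q))
    (U : {vspace V}) (hU : trivial_qrad (qres Q U)) :
  (forall (k : nat) (eps : int),
     (1 <= k)%N -> \dim U = (2 * k)%N -> has_type (qres Q U) eps ->
     #|Iso Q U|%:Z =
       2 * q%:Z ^+ (k ^ 2 - k)%N * (q%:Z ^+ k - eps) *
       \prod_(1 <= i < k) (q%:Z ^+ (2 * i)%N - 1)) /\
  (forall k : nat,
     \dim U = (2 * k + 1)%N ->
     #|Iso Q U|%:Z =
       2 * q%:Z ^+ (k ^ 2)%N *
       \prod_(1 <= i < k.+1) (q%:Z ^+ (2 * i)%N - 1)).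
Proof.
subst q; have ndU := nondeg_on_qres hU; split=> [[//|k] eps _ dimU typeU | k dimU].
  apply: card_iso_even => //; last exact: card_singular_type.
  by case: typeU => _ [[-> _]|[-> _]].
by have [] := card_iso_odd hQ ndU dimU.
Qed.
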